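(* Let $A$ be a finite simple two-sided skew brace. Then either $A\cong \mathrm{Triv}(G)$ or $A\cong \mathrm{opTriv}(G)$ for some finite simple group $G$.
   Context: A skew (left) brace is a triple $(A,+,\circ)$ such that $(A,+)$ and $(A,\circ)$ are (not necessarily abelian) groups and $a\circ(b+c)=a\circ b-a+a\circ c$ for all $a,b,c\in A$. The two groups share the same identity element, denoted $0$. It is two-sided if moreover $(a+b)\circ c=a\circ c-c+b\circ c$ for all $a,b,c\in A$. Isomorphisms of skew braces are bijections preserving both operations. An ideal of $A$ is a subset $I$ that is a normal subgroup of both $(A,+)$ and $(A,\circ)$ and satisfies $-a+a\circ x\in I$ for all $a\in A$, $x\in I$. A skew brace $A$ is simple if its only ideals are $\{0\}$ and $A$. Likewise, a group is called simple here if its only normal subgroups are the trivial subgroup and the whole group (the one-element case is not excluded). For a group $G$, the trivial skew brace $\mathrm{Triv}(G)$ is the set $G$ with $g+h=g\circ h=gh$, and the almost trivial skew brace $\mathrm{opTriv}(G)$ is the set $G$ with $g+h=hg$ and $g\circ h=gh$ (i.e. the additive group of $\mathrm{Triv}(G)$ is replaced by its opposite group). ''Either ... or'' is not exclusive. *)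

(* Defs.v *)
From HB Require Import structures.
#[warning="-notation-overridden"]
From mathcomp Require Import all_boot all_fingroup.

Set Implicit Arguments.
Unset Strict Implicit.
Unset Printing Implicit Defensive.

Declare Scope brace_scope.
Delimit Scope brace_scope with B.
Local Open Scope group_scope.
Local Open Scope brace_scope.

(* The library group structure ( *, 1, ^-1) of the carrier is (A, o); the      *)
(* mixin adds the possibly non-abelian group (A, +). That bzero = 1 is not     *)
(* assumed: it is the lemma bzeroE below.                                      *)
HB.mixin Record Group_isSkewBrace A of monoid.Group A := {
  badd : A -> A -> A;
  bzero : A;
  bopp : A -> A;
  baddA : associative badd;
  badd0b : left_id bzero badd;
  baddb0 : right_id bzero badd;
  baddNb : left_inverse bzero bopp badd;
  baddbN : right_inverse bzero bopp badd;
  bmulDr : forall a b c : A,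
    a * badd b c = badd (badd (a * b) (bopp a)) (a * c)
}.

#[short(type="skewBraceType")]
HB.structure Definition SkewBrace := {A of Group_isSkewBrace A & monoid.Group A}.

#[short(type="finSkewBraceType")]
HB.structure Definition FinSkewBrace := {A of Group_isSkewBrace A & FinGroup A}.

Notation "0" := bzero : brace_scope.
Notation "x + y" := (badd x y) : brace_scope.
Notation "- x" := (bopp x) : brace_scope.
Notation "x - y" := (x + - y) : brace_scope.

Lemma bzeroE (A : skewBraceType) : 0 = 1 :> A.
Proof.
have := bmulDr (1 : A) 0 0.
by rewrite !mul1g badd0b baddb0 badd0b => /(congr1 (badd 1)); rewrite baddb0 baddbN.
Qed.

Definition two_sided (A : skewBraceType) : Prop :=
  forall a b c : A, (a + b) * c = a * c - c + b * c.

Definition brace_isom (A B : skewBraceType) : Prop :=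
  exists f : A -> B,
    [/\ bijective f, {morph f : x y / x + y} & {morph f : x y / x * y}].

(* The carrier of A seen as the group (A, +), written multiplicatively, so     *)
(* that group_set and <| at this type refer to (A, +).                         *)
Definition additive (A : Type) : Type := A.

HB.instance Definition _ (A : skewBraceType) :=
  Choice.copy (additive A) (A : Type).
HB.instance Definition _ (A : skewBraceType) :=
  isGroup.Build (additive A) (@baddA A) (@badd0b A) (@baddb0 A)
    (@baddNb A) (@baddbN A).
HB.instance Definition _ (A : finSkewBraceType) :=
  Finite.copy (additive A) (A : Type).

Definition normal_subgroup (gT : finGroupType) (N : {set gT}) : bool :=
  group_set N && (N <| [set: gT]).

Definition is_ideal (A : finSkewBraceType) (I : {set A}) : Prop :=
  [/\ @normal_subgroup (additive A) I,
      @normal_subgroup A I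
    & forall a x : A, x \in I -> - a + a * x \in I].

Definition simple_brace (A : finSkewBraceType) : Prop :=
  forall I : {set A}, is_ideal I -> I = [set 0] \/ I = [set: A].

(* Unlike the library's simple, this allows the one-element group.             *)
Definition simple_group (gT : finGroupType) : Prop :=
  forall N : {set gT}, normal_subgroup N -> N = 1 \/ N = [set: gT].

Definition Triv (G : Type) : Type := G.
Definition opTriv (G : Type) : Type := G.

Section Triv.
Variable G : groupType.

Fact Triv_bmulDr (a b c : G) : a * (b * c) = a * b * a^-1 * (a * c).
Proof. by rewrite !mulgA mulgVK. Qed.

HB.instance Definition _ := monoid.Group.copy (Triv G) G.
HB.instance Definition _ := Group_isSkewBrace.Build (Triv G)
  (@mulgA G) (@mul1g G) (@mulg1 G) (@mulVg G) (@mulgV G) Triv_bmulDr.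

Definition opmul (x y : G) : G := y * x.

Fact opmulA : associative opmul.
Proof. by move=> x y z; rewrite /opmul mulgA. Qed.

Fact opTriv_bmulDr (a b c : G) :
  a * opmul b c = opmul (opmul (a * b) a^-1) (a * c).
Proof. by rewrite /opmul !mulgA mulgVK. Qed.

HB.instance Definition _ := monoid.Group.copy (opTriv G) G.
HB.instance Definition _ := @Group_isSkewBrace.Build (opTriv G)
  opmul 1 (@inv G) opmulA (@mulg1 G) (@mul1g G) (@mulgV G) (@mulVg G)
  opTriv_bmulDr.
End Triv.

HB.instance Definition _ (G : finGroupType) := Finite.copy (Triv G) (G : Type).
HB.instance Definition _ (G : finGroupType) := Finite.copy (opTriv G) (G : Type).

(* Main.v *)
(* Put blam a x = -a + a o x and bstar a x = blam a x - x.  Expanding          *)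
(* (b + a) o (c + d) with both distributive laws shows that bstar b d commutes *)
(* additively with -c + a o c - a.  In a two-sided skew brace conjugation in   *)
(* (A, o) is an automorphism of (A, +), so the additive centralizer C of the   *)
(* elements bstar a x and the additive center Z are ideals.  If C = 0, all     *)
(* -c + a o c - a vanish (almost trivial case); otherwise all bstar a x lie in *)
(* Z.  If Z = 0 they vanish (trivial case); otherwise (A, +) is abelian, and   *)
(* (A, +, bstar) is a finite radical ring.  A Nakayama argument then yields a  *)
(* nonzero element killed by every bstar a; such elements form an ideal, so    *)
(* bstar vanishes again.                                                       *)
Require Import Defs.
From mathcomp Require Import all_boot all_fingroup.

Set Implicit Arguments.
Unset Strict Implicit.
Unset Printing Implicit Defensive.

Local Open Scope group_scope.
Local Open Scope brace_scope.

(** The values [bstar a b] all vanish exactly when [a * b = a + b], and the values [- b + a * b - a]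
    exactly when [a * b = b + a], so one of these two defects has to be killed. Their values commute
    additively ([bstar_comm_opstar]); simplicity, applied to two centralizer ideals
    ([badd_cent_ideal]), leaves only the case of abelian addition, a finite radical ring settled by
    [bstar_ann_neq0]. Once [o] is [+] or its opposite, normal subgroups of [(A, o)] are ideals
    ([normal_is_ideal]), so this group is simple. *)

Section SkewBraceTheory.

(** * The lambda action and the star operation *)

Variable A : skewBraceType.
Implicit Types a b c d x y : A.

Lemma baddKb x y : - x + (x + y) = y.
Proof. exact: (mulKg (x : additive A)). Qed.

Lemma baddNKb x y : x + (- x + y) = y.
Proof. exact: (mulVKg (x : additive A)). Qed.

Lemma baddbK x y : y + x - x = y.
Proof. exact: (mulgK (x : additive A)). Qed.

Lemma baddbNK x y : y - x + x = y.
Proof. exact: (mulgVK (x : additive A)). Qed.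

Lemma baddbI x : injective (badd x).
Proof. exact: (mulgI (x : additive A)). Qed.

Lemma baddIb x : injective (badd^~ x).
Proof. exact: (mulIg (x : additive A)). Qed.

Lemma boppD x y : - (x + y) = - y - x.
Proof. exact: (invMg (x : additive A)). Qed.

Lemma bopp0 : - 0 = 0 :> A.
Proof. exact: (@invg1 (additive A)). Qed.

Lemma boppK : involutive (@bopp A).
Proof. exact: (@invgK (additive A)). Qed.

(** The lambda map: an action of [(A, o)] on [(A, +)] by automorphisms, see [blamD] and [blamM]. *)
Definition blam a x : A := - a + a * x.

Definition bstar a x : A := blam a x - x.

Lemma mul_blam a x : a * x = a + blam a x.
Proof. by rewrite /blam baddNKb. Qed.

Lemma blam_star a x : blam a x = bstar a x + x.
Proof. by rewrite /bstar baddbNK. Qed.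

Lemma blamD a : {morph blam a : x y / x + y}.
Proof. by move=> x y; rewrite /blam bmulDr !baddA. Qed.

Lemma blamM a b x : blam (a * b) x = blam a (blam b x).
Proof.
apply: (@baddbI (a * b)).
by rewrite -mul_blam -mulgA (mul_blam b) bmulDr -baddA.
Qed.

Lemma blam1 x : blam 1 x = x.
Proof. by rewrite /blam mul1g -bzeroE bopp0 badd0b. Qed.

Lemma blamVK a : cancel (blam a^-1) (blam a).
Proof. by move=> x; rewrite -blamM mulgV blam1. Qed.

Lemma blam0 a : blam a 0 = 0.
Proof. by apply: (@baddbI (blam a 0)); rewrite -blamD !baddb0. Qed.

Lemma blamN a x : blam a (- x) = - blam a x.
Proof. by apply: (@baddbI (blam a x)); rewrite -blamD !baddbN blam0. Qed.

Lemma blam_bstar c a x : blam c (bstar a x) = bstar (a ^ c^-1) (blam c x).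
Proof.
by rewrite /bstar blamD blamN -!blamM conjgE invgK -!mulgA mulVg mulg1.
Qed.

Lemma bstarDr a x y : bstar a (x + y) = bstar a x + (x + bstar a y - x).
Proof. by rewrite /bstar blamD boppD !baddA baddbNK. Qed.

Lemma bstar0P a x : bstar a x = 0 -> a * x = a + x.
Proof. by move=> ax0; rewrite mul_blam blam_star ax0 badd0b. Qed.

Lemma bstar0m x : bstar 0 x = 0.
Proof. by rewrite /bstar bzeroE blam1 baddbN bzeroE. Qed.

(** Makes whatever commutes with all star values commute with their additive conjugates too. *)
Lemma bstar_conjE a d b :
  d + bstar a b - d = - bstar a d + bstar a (d + b).
Proof. by rewrite bstarDr baddKb. Qed.
End SkewBraceTheory.

(** * Consequences of two-sidedness *)

Section TwoSided.
Variable A : skewBraceType.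
Hypothesis h2 : two_sided A.
Implicit Types a b c d x y : A.

(* Expand (b + a) * (c + d) with the two distributive laws in both orders. *)
Lemma bstar_comm_opstar a b c d :
  bstar b d + (- c + a * c - a) = (- c + a * c - a) + bstar b d.
Proof.
have := bmulDr (b + a) c d; rewrite h2 (h2 b a c) (h2 b a d) !bmulDr !boppD.
rewrite /bstar /blam !baddA => /baddIb.
by rewrite -!baddA => /baddbI.
Qed.

Lemma mul_subD c u v w : (u - v + w) * c = u * c - v * c + w * c.
Proof.
have E : (u - v) * c = u * c - v * c + c.
  by rewrite -[in RHS](baddbNK v u) (h2 (u - v)) baddbK baddbNK.
by rewrite h2 E baddbK.
Qed.

(** Left translation by [c^-1] turns [x + y] into some [u - v + w] with [v = c^-1]; right
    translation by [c] respects this shape and sends [v] to 0. *)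
Lemma conj_badd c : {morph (fun x => x ^ c) : x y / x + y}.
Proof.
move=> x y; rewrite !conjgE mulgA bmulDr mul_subD mulVg -bzeroE.
by rewrite bopp0 baddb0 !mulgA.
Qed.

Lemma conj_bzero c : 0 ^ c = 0 :> A.
Proof. by rewrite bzeroE conj1g. Qed.

Lemma conj_bopp c x : (- x) ^ c = - x ^ c.
Proof. by apply: (@baddbI _ (x ^ c)); rewrite -conj_badd !baddbN conj_bzero. Qed.

Lemma conj_bstar c a x : (bstar a x) ^ c = bstar (a ^ c) (x ^ c).
Proof. by rewrite /bstar /blam !conj_badd !conj_bopp conjMg. Qed.

(** * Abelian addition: the radical ring *)

Section CommutativeAddition.
Hypothesis addC : commutative (@badd A).

Lemma bstarDl a b x : bstar (a + b) x = bstar a x + bstar b x.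
Proof.
rewrite /bstar /blam h2 boppD (addC (- b)) -!baddA; congr (_ + _).
by rewrite (addC (- b)) -!baddA; do 2 congr (_ + _); rewrite baddA addC.
Qed.

Lemma bstarNl a x : bstar (- a) x = - bstar a x.
Proof. by apply: (@baddbI _ (bstar a x)); rewrite -bstarDl !baddbN bstar0m. Qed.

(** Associativity of the star product, since [c * a - c - a] is [bstar c a] when addition
    commutes. *)
Lemma bstar_bstar c a x : bstar c (bstar a x) = bstar (c * a - c - a) x.
Proof.
rewrite !bstarDl !bstarNl; congr (_ - _).
by rewrite /bstar blamD blamN -blamM boppD boppK !baddA baddbNK.
Qed.

(** Quasi-regularity: the hypothesis gives [(- a) * x = - a], and [- a] cancels in [(A, o)]. *)
Lemma bstar_fixed a x : bstar a x = x -> x = 0.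
Proof.
move=> ax; have : bstar (- a) x = - x by rewrite bstarNl ax.
rewrite /bstar -[RHS]badd0b => /baddIb.
rewrite /blam boppK -[RHS](baddbN a) => /baddbI.
by rewrite -[RHS]mulg1 -bzeroE => /mulgI.
Qed.
End CommutativeAddition.
End TwoSided.

(** * Ideals of finite skew braces *)

Section FiniteIdeals.
Variable A : finSkewBraceType.
Implicit Types (a b c d x y : A) (I S : {set A}).

Lemma is_idealI I :
    0 \in I -> {in I &, forall x y, x + y \in I} ->
    (forall d, {in I, forall x, d + x - d \in I}) ->
    (forall a, {in I, forall x, blam a x \in I}) ->
    (forall c, {in I, forall x, x ^ c \in I}) ->
  is_ideal I.
Proof.
move=> I0 ID Iadd Ilam Iconj; split; last by move=> a x /(Ilam a).
- apply/andP; split; first by apply/group_setP; split.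
  apply/andP; split; first exact: subsetT.
  apply/subsetP=> d _; rewrite inE; apply/subsetP=> _ /imsetP [x xI ->].
  by have := Iadd (- d) x xI; rewrite boppK -baddA.
- apply/andP; split.
    apply/group_setP; split; first by rewrite -bzeroE.
    by move=> x y xI yI; rewrite mul_blam ID ?Ilam.
  apply/andP; split; first exact: subsetT.
  apply/subsetP=> d _; rewrite inE; apply/subsetP=> _ /imsetP [x xI ->].
  exact: Iconj.
Qed.

Definition badd_cent S := [set x : A | [forall s in S, x + s == s + x]].

Lemma badd_centP S x : reflect {in S, forall s, x + s = s + x} (x \in badd_cent S).
Proof. by rewrite inE; apply: eqfun_inP. Qed.

(** Automorphisms of [(A, +)] preserving [S] preserve its centralizer. Used for [S] the star values
    and for [S] everything. *)
Lemma badd_cent_ideal S (h2 : two_sided A) :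
    (forall a, {in S, forall s, blam a s \in S}) ->
    (forall c, {in S, forall s, s ^ c \in S}) ->
    (forall d, {in badd_cent S & S, forall x s,
       x + (- d + s + d) = - d + s + d + x}) ->
  is_ideal (badd_cent S).
Proof.
move=> Slam Sconj Scent; apply: is_idealI.
- by apply/badd_centP=> s _; rewrite badd0b baddb0.
- move=> x y /badd_centP xS /badd_centP yS; apply/badd_centP=> s sS.
  by rewrite -baddA yS // !baddA xS.
- move=> d x xS; apply/badd_centP=> s sS.
  apply: (@baddbI _ (- d)); apply: (@baddIb _ d).
  have := Scent d x s xS sS; rewrite -!baddA baddKb => ->.
  by rewrite baddNb baddb0.
- move=> a x /badd_centP xS; apply/badd_centP=> s sS.
  by rewrite -[s](blamVK a) -!blamD xS ?Slam.
- move=> c x /badd_centP xS; apply/badd_centP=> s sS.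
  by rewrite -[s](conjgKV c) -!(conj_badd h2) xS ?Sconj.
Qed.

Definition bstars := [set bstar p.1 p.2 | p : A * A].

Lemma mem_bstars a b : bstar a b \in bstars.
Proof. exact: (imset_f _ (x := (a, b))). Qed.

Lemma bstars_cent_ideal : two_sided A -> is_ideal (badd_cent bstars).
Proof.
move=> h2; apply: badd_cent_ideal => //.
- by move=> a _ /imsetP [[b c] _ ->]; rewrite blam_bstar mem_bstars.
- by move=> a _ /imsetP [[b c] _ ->]; rewrite conj_bstar ?mem_bstars.
- move=> d x _ /badd_centP xS /imsetP [[a b] _ ->] /=.
  have := bstar_conjE a (- d) b; rewrite boppK => ->.
  have xN := @commuteV (additive A) x _ (xS _ (mem_bstars a (- d))).
  exact: (commuteM xN (xS _ (mem_bstars a _))).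
Qed.

Lemma badd_center_ideal : two_sided A -> is_ideal (badd_cent setT).
Proof.
move=> h2; apply: badd_cent_ideal => // [a s _ | c s _ | d x s /badd_centP xS _].
- exact: in_setT.
- exact: in_setT.
- exact/xS/in_setT.
Qed.

Definition bstar_ann := [set x : A | [forall a, bstar a x == 0]].

Lemma bstar_annP x : reflect (forall a, bstar a x = 0) (x \in bstar_ann).
Proof. by rewrite inE; apply: eqfunP. Qed.

Lemma bstar_ann_ideal :
  two_sided A -> commutative (@badd A) -> is_ideal bstar_ann.
Proof.
move=> h2 addC; apply: is_idealI.
- by apply/bstar_annP=> a; rewrite /bstar blam0 baddbN.
- move=> x y /bstar_annP x0 /bstar_annP y0; apply/bstar_annP=> a.
  by rewrite bstarDr x0 y0 badd0b baddb0 baddbN.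
- by move=> d x xA; rewrite addC baddKb.
- by move=> a x /[dup] /bstar_annP x0 xA; rewrite blam_star x0 badd0b.
- move=> c x /bstar_annP x0; apply/bstar_annP=> a.
  by rewrite -[a](conjgKV c) -conj_bstar // x0 conj_bzero.
Qed.

(* A nonzero m with the fewest values bstar a m works: if n = bstar b m is    *)
(* nonzero, then n has the same values, so n = bstar a n and thus n = 0.      *)
Lemma bstar_ann_neq0 x :
  two_sided A -> commutative (@badd A) -> x != 0 ->
  exists2 m, m \in bstar_ann & m != 0.
Proof.
move=> h2 addC x0; pose L y := [set bstar a y | a : A].
have mL a y : bstar a y \in L y by apply/imsetP; exists a.
case: (@arg_minnP _ x [pred y | y != 0] (fun y => #|L y|) x0) => m m0 minm.
exists m => //; apply/bstar_annP=> b; apply/eqP/contraT=> n0.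
have sL : L (bstar b m) \subset L m.
  by apply/subsetP=> _ /imsetP [a _ ->]; rewrite bstar_bstar.
have eL : L (bstar b m) = L m by apply/eqP; rewrite eqEcard sL minm.
have: bstar b m \in L (bstar b m) by rewrite eL.
case/imsetP=> a _ /esym /(bstar_fixed h2 addC) n0'.
by rewrite n0' eqxx in n0.
Qed.

(** * Simple two-sided skew braces *)

Lemma simple_ideal_full I x :
  simple_brace A -> is_ideal I -> x \in I -> x != 0 -> I = [set: A].
Proof. by move=> hs /hs [-> | //]; rewrite inE => ->. Qed.

Lemma simple_bstar0 :
    simple_brace A -> two_sided A -> commutative (@badd A) ->
  forall a b, bstar a b = 0.
Proof.
move=> hs h2 addC a b; apply/eqP/contraT=> n0.
have [m mA m0] := bstar_ann_neq0 h2 addC n0.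
have := in_setT b; rewrite -(simple_ideal_full hs (bstar_ann_ideal h2 addC) mA m0).
by move/bstar_annP=> b0; rewrite b0 eqxx in n0.
Qed.

Lemma simple_bstar0_or_opstar0 : simple_brace A -> two_sided A ->
  (forall a b, bstar a b = 0) \/ (forall a b, - b + a * b - a = 0).
Proof.
move=> hs h2.
have [|/forallPn [a /forallPn [b op0]]] :=
  boolP [forall a : A, forall b : A, - b + a * b - a == 0].
  by move/forallP=> op0; right=> a b; apply/eqP/(forallP (op0 a)).
left.
(* The nonzero value [- b + a * b - a] lies in this ideal, so all star values are additively
   central. *)
have CT : badd_cent bstars = setT.
  apply: (simple_ideal_full hs (bstars_cent_ideal h2) _ op0).
  by apply/badd_centP=> _ /imsetP [[c d] _ ->]; rewrite bstar_comm_opstar.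
move=> c d; apply/eqP/contraT=> cd0; suff addC : commutative (@badd A).
  by rewrite simple_bstar0 ?eqxx in cd0.
(* A nonzero star value now lies in the additive center, forcing addition to commute. *)
have ZT : badd_cent setT = setT.
  apply: (simple_ideal_full hs (badd_center_ideal h2) _ cd0).
  apply/badd_centP=> x _; have: x \in badd_cent bstars by rewrite CT.
  by move/badd_centP=> ->; rewrite ?mem_bstars.
move=> x y; have /badd_centP xZ : x \in badd_cent setT by rewrite ZT in_setT.
exact/xZ/in_setT.
Qed.

(** In the first case [blam a] is the identity, in the second it is conjugation by [a^-1] in
    [(A, o)]. *)
Lemma normal_is_ideal (N : {set A}) :
    (forall a b : A, a * b = a + b) \/ (forall a b : A, a * b = b + a) ->
  normal_subgroup N -> is_ideal N.
Proof.
move=> E /andP [gN nN]; pose G := Group gN.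
have N1 : 1 \in N := group1 G.
have NM : {in N &, forall x y, x * y \in N} by move=> x y; apply: (@groupM _ G).
have NJ c : {in N, forall x, x ^ c \in N}.
  by move=> x xN; rewrite memJ_norm // (subsetP (normal_norm nN)) ?inE.
have oppE x : - x = x^-1.
  apply: (@baddbI _ x); rewrite baddbN.
  by case: E => E; rewrite -E (mulgV, mulVg) bzeroE.
have addE x y : x + y = x * y \/ x + y = y * x.
  by case: E => E; [left | right]; rewrite E.
apply: is_idealI => //.
- by rewrite bzeroE.
- by move=> x y xN yN; case: (addE x y) => ->; apply: NM.
- move=> d x xN; rewrite oppE; case: E => E.
    by rewrite -!E -mulgA -{1}[d]invgK -conjgE NJ.
  by rewrite -!E -conjgE NJ.
- move=> a x xN; rewrite /blam oppE; case: E => E.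
    by rewrite -E mulKg.
  by rewrite -E -mulgA -{1}[a]invgK -conjgE NJ.
Qed.
End FiniteIdeals.

Theorem corollary4p8 (A : finSkewBraceType) (hs : simple_brace A)
    (h2 : two_sided A) :
  exists G : finGroupType,
    simple_group G /\ (brace_isom A (Triv G) \/ brace_isom A (opTriv G)).
Proof.
have E : (forall a b : A, a * b = a + b) \/ (forall a b : A, a * b = b + a).
  have [st0|op0] := simple_bstar0_or_opstar0 hs h2; [left | right] => a b.
    exact/bstar0P/st0.
  by apply: (@baddbI _ (- b)); apply: (@baddIb _ (- a)); rewrite op0 baddKb baddbN.
(* Both models retain [o] as group law, so [G] is [(A, o)] and the isomorphism is the identity
   map. *)
exists A; split.
  move=> N /(normal_is_ideal E) /hs [] ->; last by right.
  by left; rewrite bzeroE.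
case: E => E; [left | right]; exists id.
  by split=> // [|x y]; [exists id | rewrite -E].
by split=> // [|x y]; [exists id | rewrite -E].
Qed.
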